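(* Let $H$ be a $(0,1,2)$-multigraph of order $n\ge 3$ with exactly two distinct main eigenvalues whose $B$-graph is the cycle $C_n$, and let $a,b$ be integers such that $a\,d(v)+b=s(v)$ for every $v\in V(H)$. Label the vertices as follows: if $n$ is even, $V(H)=\{u_1,\dots,u_{n/2},v_1,\dots,v_{n/2}\}$ with $u_1u_2\cdots u_{n/2}v_{n/2}\cdots v_2v_1u_1$ the cycle of the $B$-graph; if $n$ is odd, $V(H)=\{u_1,\dots,u_{(n-1)/2},v_1,\dots,v_{(n-1)/2},x\}$ with $u_1\cdots u_{(n-1)/2}\,x\,v_{(n-1)/2}\cdots v_1u_1$ the cycle; and assume $w(u_1,v_1)=2$. If $w(u_1,u_2)=w(v_1,v_2)=2$, then $H$ is isomorphic to $U^4_{5t}$ or to $U^5_{4t}$ for some $t\ge 1$.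
   Context: A $(0,1,2)$-multigraph $H$ is a loopless multigraph in which any two distinct vertices $u,v$ are joined by $w(u,v)\in\{0,1,2\}$ edges; its adjacency matrix has $(u,v)$-entry $w(u,v)$. The degree is $d(v)=\sum_u w(u,v)$ and $s(v)=\sum_{u\sim v}w(u,v)d(u)$. The $B$-graph of $H$ is the simple graph on $V(H)$ with $u\sim v$ iff $w(u,v)\ge1$. An eigenvalue of the adjacency matrix is main if its eigenspace is not orthogonal to the all-ones vector. For $n_1\ge1,n_2\ge0,t\ge1$, $[n_1,n_2]_t$ denotes the $(0,1,2)$-multigraph on $x_0,\dots,x_{N-1}$, $N=(n_1+n_2)t$, whose edges join $x_i$ and $x_{i+1\bmod N}$ with multiplicity $2$ if $(i\bmod(n_1+n_2))<n_1$ and $1$ otherwise (around the cycle: $n_1$ consecutive double edges then $n_2$ consecutive single edges, repeated $t$ times). $U^4_{5t}=[3,2]_t$, $U^5_{4t}=[3,1]_t$. *)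

(* Defs.v *)
From HB Require Import structures.
From mathcomp Require Import all_boot all_order all_algebra.

Set Implicit Arguments.
Unset Strict Implicit.
Unset Printing Implicit Defensive.

Import GRing.Theory Num.Theory.
Local Open Scope ring_scope.

(* A multigraph on V is given by its multiplicity function w. *)
Definition mgraph012 (V : finType) (w : V -> V -> nat) : Prop :=
  [/\ forall v, w v v = 0%N, forall u v, w u v = w v u
    & forall u v, (w u v <= 2)%N].

Definition Bgraph (V : finType) (w : V -> V -> nat) : rel V :=
  fun u v => (1 <= w u v)%N.

Definition deg (V : finType) (w : V -> V -> nat) (v : V) : nat :=
  (\sum_(u : V) w u v)%N.

Definition sdeg (V : finType) (w : V -> V -> nat) (v : V) : nat :=
  (\sum_(u : V | Bgraph w u v) w u v * deg w u)%N.

Definition adjmx (R : rcfType) (V : finType) (w : V -> V -> nat) :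
    'M[R]_#|V| :=
  \matrix_(i, j) (w (enum_val i) (enum_val j))%:R.

Definition main_eigenvalue (R : rcfType) (n : nat) (A : 'M[R]_n) (l : R) :
    Prop :=
  eigenvalue A l /\
  exists2 v : 'rV[R]_n, (v <= eigenspace A l)%MS
    & v *m (const_mx 1 : 'cV[R]_n) != 0.

Definition two_main_eigenvalues (R : rcfType) (n : nat) (A : 'M[R]_n) : Prop :=
  exists l1 l2 : R, l1 != l2 /\
    forall l, main_eigenvalue A l <-> l = l1 \/ l = l2.

(* Used both for multigraphs (T = nat) and for simple graphs (T = bool). *)
Definition isomorphic (T : Type) (V W : finType)
    (g : V -> V -> T) (h : W -> W -> T) : Prop :=
  exists2 f : V -> W, bijective f & forall x y, h (f x) (f y) = g x y.

(* The cycle C_n, for n >= 3; ordS i is i + 1 modulo n. *)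
Definition cycle_graph (n : nat) : rel 'I_n :=
  fun i j => (j == ordS i) || (i == ordS j).

(* [n1, n2]_t, a (0,1,2)-multigraph when (n1 + n2) * t >= 3. *)
Definition bracket (n1 n2 t : nat) (x y : 'I_((n1 + n2) * t)) : nat :=
  let m (i : 'I_((n1 + n2) * t)) := if (i %% (n1 + n2) < n1)%N then 2 else 1 in
  if y == ordS x then m x else if x == ordS y then m y else 0%N.

Definition U4 (t : nat) := @bracket 3 2 t.
Definition U5 (t : nat) := @bracket 3 1 t.

(* us lists u_1, u_2, ... and vs lists v_1, v_2, ...; xs is empty when the order
   is even and consists of the single vertex x when it is odd.  The sizes and
   the absence of repetition make the labels exhaust V. *)
Definition cycle_labelling (V : finType) (w : V -> V -> nat)
    (us xs vs : seq V) : Prop :=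
  [/\ size us = #|V|./2, size vs = #|V|./2, size xs = odd #|V|
    & ucycle (Bgraph w) (us ++ xs ++ rev vs)].

(* Main.v *)
Require Import Defs.
From HB Require Import structures.
From mathcomp Require Import all_boot all_order all_algebra.
From mathcomp Require Import zify.

(** Let [e i] be the multiplicity of the [i]-th edge of the cycle.  The relation
    [a d + b = s] at the vertex between two consecutive edges involves only four
    consecutive multiplicities and, once [a] and [b] are known, determines the
    last of them from the first three.  [H] has two main eigenvalues, so it is
    not regular, and the given three consecutive double edges are followed, at
    some point, by a single one.  The windows [2,2,2,1] and [2,2,1,s] then give
    [4a + b = 14] and [3a + b = 9 + s]: [s = 2] means [(a, b) = (3, 2)] and
    propagates to [2,2,2,1,2,2,2,1,...], while [s = 1] means [(a, b) = (4, -2)]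
    and propagates to [2,2,2,1,1,2,2,2,1,1,...]. *)

Set Implicit Arguments.
Unset Strict Implicit.
Unset Printing Implicit Defensive.

Import GRing.Theory Num.Theory.
Local Open Scope ring_scope.

(** * Integer sequences over 1 and 2 obeying the local rule *)

Section MultiplicitySequence.

Variables (e : nat -> nat) (a b : int).

Hypothesis e12 : forall i, e i = 1%N \/ e i = 2%N.

Hypothesis e_rule : forall i,
  a * (e i.+1 + e i.+2)%N%:Z + b =
  (e i.+1 * (e i + e i.+1) + e i.+2 * (e i.+2 + e i.+3))%N%:Z.

(** The window of three 2s slides forward until it meets a 1; the induction is on the distance [m]
    to a known 1. *)
Lemma exists_2221 (k m : nat) :
    e k = 2%N -> e k.+1 = 2%N -> e k.+2 = 2%N -> e (k + m)%N = 1%N ->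
  exists j, [/\ e j = 2%N, e j.+1 = 2%N, e j.+2 = 2%N & e j.+3 = 1%N].
Proof.
elim: m k => [|m IHm] k ek ek1 ek2; first by rewrite addn0 ek.
rewrite addnS -addSn; have [ek3 _|ek3] := e12 k.+3; first by exists k.
exact: IHm.
Qed.

Lemma propagate_2221 (j : nat) :
    e j = 2%N -> e j.+1 = 2%N -> e j.+2 = 2%N -> e j.+3 = 1%N ->
  exists2 n2, n2 = 1%N \/ n2 = 2%N & forall i,
    e (j + i)%N = if (i %% (3 + n2) < 3)%N then 2%N else 1%N.
Proof.
move=> e0 e1 e2 e3.
have abq := e_rule j; rewrite e0 e1 e2 e3 in abq.
have abr := e_rule j.+1; rewrite e1 e2 e3 in abr.
have [e4|e4] := e12 j.+4; rewrite e4 in abr.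
- have [a4 b2] : a = 4 /\ b = -2 by lia.
  exists 2%N; [by right | move=> i].
  (* Each block forces the next one: in [e_rule] the newest term has a nonzero coefficient, so three
     known terms determine it. *)
  have blk q : [/\ e (j + q * 5) = 2, e (j + q * 5).+1 = 2,
      e (j + q * 5).+2 = 2, e (j + q * 5).+3 = 1 & e (j + q * 5).+4 = 1]%N.
    elim: q => [|q [f0 f1 f2 f3 f4]]; first by rewrite mul0n addn0.
    have -> : (j + q.+1 * 5 = (j + q * 5).+4.+1)%N by lia.
    move: (j + q * 5)%N f0 f1 f2 f3 f4 => k f0 f1 f2 f3 f4.
    have f5 : e k.+4.+1 = 2%N.
      by have := e_rule k.+2; have := e12 k.+4.+1; rewrite f2 f3 f4; lia.
    have f6 : e k.+4.+2 = 2%N.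
      by have := e_rule k.+3; have := e12 k.+4.+2; rewrite f3 f4 f5; lia.
    have f7 : e k.+4.+3 = 2%N.
      by have := e_rule k.+4; have := e12 k.+4.+3; rewrite f4 f5 f6; lia.
    have f8 : e k.+4.+4 = 1%N.
      by have := e_rule k.+4.+1; have := e12 k.+4.+4; rewrite f5 f6 f7; lia.
    have f9 : e k.+4.+4.+1 = 1%N.
      by have := e_rule k.+4.+2; have := e12 k.+4.+4.+1; rewrite f6 f7 f8; lia.
    by [].
  have [f0 f1 f2 f3 f4] := blk (i %/ 5)%N.
  (* The quotient selects the block; the five residues are then checked one by one. *)
  rewrite {1}(divn_eq i 5) addnA.
  have := ltn_pmod i (isT : (0 < 5)%N); move: (i %% 5)%N.
  by do 5?[case=> [|]]; rewrite ?addn0 ?addnS ?addn0.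
- have [a3 b2] : a = 3 /\ b = 2 by lia.
  exists 1%N; [by left | move=> i].
  have blk q : [/\ e (j + q * 4) = 2, e (j + q * 4).+1 = 2,
      e (j + q * 4).+2 = 2 & e (j + q * 4).+3 = 1]%N.
    elim: q => [|q [f0 f1 f2 f3]]; first by rewrite mul0n addn0.
    have -> : (j + q.+1 * 4 = (j + q * 4).+4)%N by lia.
    move: (j + q * 4)%N f0 f1 f2 f3 => k f0 f1 f2 f3.
    have f4 : e k.+4 = 2%N.
      by have := e_rule k.+1; have := e12 k.+4; rewrite f1 f2 f3; lia.
    have f5 : e k.+4.+1 = 2%N.
      by have := e_rule k.+2; have := e12 k.+4.+1; rewrite f2 f3 f4; lia.
    have f6 : e k.+4.+2 = 2%N.
      by have := e_rule k.+3; have := e12 k.+4.+2; rewrite f3 f4 f5; lia.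
    have f7 : e k.+4.+3 = 1%N.
      by have := e_rule k.+4; have := e12 k.+4.+3; rewrite f4 f5 f6; lia.
    by [].
  have [f0 f1 f2 f3] := blk (i %/ 4)%N.
  rewrite {1}(divn_eq i 4) addnA.
  have := ltn_pmod i (isT : (0 < 4)%N); move: (i %% 4)%N.
  by do 4?[case=> [|]]; rewrite ?addn0 ?addnS ?addn0.
Qed.

End MultiplicitySequence.

(** Shifting the initial 2, 2, 2 by [n] gives three 2s again, and modulo [3 + n2] a run of three 2s
    can start only at residue 0. *)
Lemma period_dvdn (e : nat -> nat) (n n2 j : nat) :
    n2 = 1%N \/ n2 = 2%N -> (forall i, e (i + n)%N = e i) ->
    (forall i, e (j + i)%N = if (i %% (3 + n2) < 3)%N then 2%N else 1%N) ->
  (3 + n2 %| n)%N.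
Proof.
move=> n2P e_per eP.
have en i : e (j + i)%N = e (j + (i + n))%N by rewrite addnA e_per.
have e0 := en 0%N; have e1 := en 1%N; have e2 := en 2%N.
rewrite !eP in e0 e1 e2.
by case: n2P e0 e1 e2 => -> /=; (do 3!case: ifP => ?) => //; lia.
Qed.

(** * Main eigenvalues of regular multigraphs *)

(** The all-ones column is an eigenvector for [d]; evaluating [v *m A *m 1] in two ways gives [l]
    and [d] times the same nonzero scalar. *)
Lemma regular_main_eigenvalue (R : rcfType) (V : finType) (w : V -> V -> nat)
    (d : nat) (l : R) :
    (forall u v, w u v = w v u) -> (forall v, deg w v = d) ->
  main_eigenvalue (adjmx R w) l -> l = d%:R.
Proof.
move=> w_sym w_deg [_ [v /eigenspaceP vA v1]].
have A1 : adjmx R w *m const_mx 1 = d%:R *: (const_mx 1 : 'cV[R]_#|V|).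
  apply/matrixP => i k; rewrite !mxE mulr1 -(w_deg (enum_val i)) /deg natr_sum.
  rewrite (eq_bigr (fun u => (w (enum_val i) u)%:R)) => [|u _]; last first.
    by rewrite w_sym.
  rewrite (big_enum_val (A := V) (fun u => (w (enum_val i) u)%:R)).
  by apply: eq_bigr => u _; rewrite !mxE mulr1.
have : l *: (v *m const_mx 1) = d%:R *: (v *m (const_mx 1 : 'cV[R]_#|V|)).
  by rewrite scalemxAl -vA -mulmxA A1 -scalemxAr.
move/eqP; rewrite -subr_eq0 -scalerBl scaler_eq0 (negPf v1) orbF subr_eq0.
by move/eqP.
Qed.

Lemma two_main_not_regular (R : rcfType) (V : finType) (w : V -> V -> nat)
    (d : nat) :
    (forall u v, w u v = w v u) -> two_main_eigenvalues (adjmx R w) ->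
  ~ (forall v, deg w v = d).
Proof.
move=> w_sym [l1 [l2 [/eqP neq_l lP]]] w_deg; apply: neq_l.
have /(regular_main_eigenvalue w_sym w_deg) -> : main_eigenvalue (adjmx R w) l1.
  by apply/lP; left.
have /(regular_main_eigenvalue w_sym w_deg) -> // :
  main_eigenvalue (adjmx R w) l2 by apply/lP; right.
Qed.

(** * Neighbourhoods and edge multiplicities along a cycle *)

Lemma sdegE (V : finType) (w : V -> V -> nat) (v : V) :
  sdeg w v = (\sum_u w u v * deg w u)%N.
Proof.
rewrite /sdeg [RHS](bigID (fun u => Bgraph w u v)) /= [X in (_ + X)%N]big1.
  by rewrite addn0.
by move=> u; rewrite /Bgraph -eqn0Ngt => /eqP ->.
Qed.

Lemma cycle_graph_neighbours (n : nat) (i j : 'I_n) :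
  cycle_graph i j -> j \in [:: ordS i; ord_pred i].
Proof.
rewrite !inE => /orP[/eqP->|/eqP->]; first by rewrite eqxx.
by rewrite ordSK eqxx orbT.
Qed.

(** Images of neighbours of [v] lie among the two cyclic neighbours of [f v], and the distinct
    [f x], [f y] already exhaust these. *)
Lemma cycle_neighbours (V : finType) (g : rel V) (n : nat) (v x y z : V) :
    isomorphic g (@cycle_graph n) -> g v x -> g v y -> x != y -> g v z ->
  z = x \/ z = y.
Proof.
move=> [f /bij_inj f_inj fg] vx vy neq_xy vz.
have nbr t : g v t -> f t \in [:: ordS (f v); ord_pred (f v)].
  by rewrite -fg; apply: cycle_graph_neighbours.
have := nbr _ vx; have := nbr _ vy; have := nbr _ vz; rewrite !inE.
have neq_f : f x != f y by rewrite (inj_eq f_inj).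
move=> /pred2P[] Ez /pred2P[] Ey /pred2P[] Ex; rewrite Ex Ey ?eqxx // in neq_f.
all: by [left; apply: f_inj; rewrite Ez | right; apply: f_inj; rewrite Ez].
Qed.

Definition walk_mult (V : Type) (w : V -> V -> nat) (x : nat -> V) (i : nat) :=
  w (x i) (x i.+1).

Section CycleWalk.

Variables (V : finType) (w : V -> V -> nat) (x : nat -> V) (n : nat).

Hypothesis n_ge3 : (3 <= n)%N.
Hypothesis w_mgraph : mgraph012 w.
Hypothesis w_cycle : isomorphic (Bgraph w) (@cycle_graph #|V|).
(** The walk runs around the cycle forever, so that indices are plain naturals; this condition
    combines periodicity with injectivity on one turn. *)
Hypothesis x_eq : forall i j, x i = x j <-> i = j %[mod n].
Hypothesis x_onto : forall v, exists i, v = x i.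
Hypothesis x_step : forall i, Bgraph w (x i) (x i.+1).

Local Notation e := (walk_mult w x).

Let w_sym u v : w u v = w v u. Proof. by case: w_mgraph. Qed.

Lemma walk_mult12 i : e i = 1%N \/ e i = 2%N.
Proof.
have := x_step i; case: w_mgraph => _ _ /(_ (x i) (x i.+1)).
by rewrite /Bgraph /walk_mult; case: (w _ _) => [|[|[|]]] //; [left | right].
Qed.

Lemma walk_neighbours_neq i : x i != x i.+2.
Proof.
apply/eqP => /x_eq /eqP; rewrite -{1}(addn0 i) -addn2 eqn_modDl.
by rewrite mod0n modn_small.
Qed.

Lemma walk_neighbours i v : Bgraph w (x i.+1) v -> v = x i \/ v = x i.+2.
Proof.
apply: (cycle_neighbours w_cycle) (walk_neighbours_neq i); last exact: x_step.
by rewrite /Bgraph w_sym; apply: x_step.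
Qed.

(** Serves both [deg] (with [F] constantly 1) and [sdeg] (with [F] the degree). *)
Lemma walk_sum (F : V -> nat) i :
  (\sum_u w u (x i.+1) * F u = e i * F (x i) + e i.+1 * F (x i.+2))%N.
Proof.
rewrite (bigD1 (x i)) //= (bigD1 (x i.+2)) /=; last first.
  by rewrite eq_sym walk_neighbours_neq.
rewrite big1 ?addn0 => [|u /andP[ui ui2]]; first by rewrite /walk_mult (w_sym (x i.+2)).
have [/eqP->//|] := boolP (w u (x i.+1) == 0)%N; rewrite -lt0n w_sym.
by move/walk_neighbours => [] Eu; rewrite Eu eqxx in ui ui2.
Qed.

Lemma walk_deg i : deg w (x i.+1) = (e i + e i.+1)%N.
Proof.
rewrite /deg -[e i]muln1 -[e i.+1]muln1 -(walk_sum (fun=> 1%N)).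
by apply: eq_bigr => u _; rewrite muln1.
Qed.

Lemma walk_period i : x (i + n)%N = x i.
Proof. by apply/x_eq; rewrite modnDr. Qed.

Lemma walk_rule (a b : int) i :
    (forall v, a * (deg w v)%:Z + b = (sdeg w v)%:Z) ->
  a * (e i.+1 + e i.+2)%N%:Z + b =
  (e i.+1 * (e i + e i.+1) + e i.+2 * (e i.+2 + e i.+3))%N%:Z.
Proof.
by move/(_ (x i.+2)); rewrite sdegE walk_sum !walk_deg.
Qed.

Lemma walk_not_all_double (R : rcfType) k :
  two_main_eigenvalues (adjmx R w) -> exists m, e (k + m)%N = 1%N.
Proof.
move=> /(two_main_not_regular w_sym) w_nreg.
have e_mod i : e i = e (i %% n)%N.
  rewrite /walk_mult; congr w; apply/x_eq; rewrite ?modn_mod //.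
  by rewrite -addn1 -(addn1 (i %% n)) modnDml.
have [/existsP[i /eqP ei]|] := boolP [exists i : 'I_n, e i == 1%N].
  (* The single edge [i] may precede [k]; this offset leads to index [k * n + i], the same edge some
     turns later. *)
  exists (k * n.-1 + i)%N; rewrite -ei e_mod [in RHS]e_mod; congr e.
  have -> : (k + (k * n.-1 + i) = k * n + i)%N by nia.
  by rewrite modnMDl.
(* With every edge double, the multigraph would be 4-regular. *)
rewrite negb_exists => /forallP e_ne1; case: (w_nreg 4%N) => v.
have e2 i : e i = 2%N.
  have n_gt0 : (0 < n)%N by lia.
  have := e_ne1 (Ordinal (ltn_pmod i n_gt0)); rewrite /= -e_mod.
  by have [] := walk_mult12 i => ->.
have [i ->] := x_onto v.
have -> : x i = x (i + n.-1).+1 by rewrite -addnS prednK ?walk_period //; lia.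
by rewrite walk_deg !e2.
Qed.

Lemma walk_bracket_isomorphic (n1 n2 t j : nat) :
    #|V| = n -> n = ((n1 + n2) * t)%N ->
    (forall i, e (j + i)%N = if (i %% (n1 + n2) < n1)%N then 2%N else 1%N) ->
  isomorphic w (@bracket n1 n2 t).
Proof.
move=> card_V def_n eP.
pose g (i : 'I_((n1 + n2) * t)) := x (j + i)%N.
have x_ord (i k : 'I_((n1 + n2) * t)) : x (j + i)%N = x (j + k)%N -> i = k.
  move/x_eq/eqP; rewrite eqn_modDl def_n !modn_small ?ltn_ord // => /eqP.
  exact: val_inj.
have x_ordS (i : 'I_((n1 + n2) * t)) : x (j + ordS i)%N = x (j + i).+1.
  by apply/x_eq; rewrite def_n modnDmr addnS.
have g_bij : bijective g.
  by apply: inj_card_bij; [exact: x_ord | rewrite card_V card_ord def_n].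
have gP i k : w (g i) (g k) = bracket i k.
  rewrite /bracket; case: eqP => [->|neq_k]; first by rewrite -eP /g x_ordS.
  case: eqP => [->|neq_i]; first by rewrite -eP w_sym /g x_ordS.
  (* A positive multiplicity would make [g k] one of the two walk neighbours of [g i], hence [i] and
     [k] cyclically consecutive. *)
  apply/eqP; rewrite -leqn0 leqNgt; apply/negP.
  have [m Em] : exists m, g i = x m.+1.
    exists (j + i + n.-1)%N; rewrite -addnS prednK; last by lia.
    by rewrite walk_period.
  rewrite Em => /walk_neighbours[] Ek; last first.
    apply: neq_k; apply: x_ord; rewrite x_ordS -/(g k) Ek.
    move/x_eq: Em => Em; apply/x_eq.
    by rewrite -(addn1 m.+1) -(addn1 (j + i)) -modnDml -Em modnDml.
  apply: neq_i; apply: x_ord; rewrite x_ordS -/(g i) Em.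
  move/x_eq: Ek => Ek; apply/x_eq.
  by rewrite -(addn1 m) -(addn1 (j + k)) -modnDml -Ek modnDml.
have [f fK gK] := g_bij.
exists f; first by exists g.
by move=> u v; rewrite -gP !gK.
Qed.

End CycleWalk.

(** * From a cyclic list of all vertices to an infinite walk *)

Section CycleLabelling.

Variables (V : finType) (w : V -> V -> nat) (c : seq V) (x0 : V).

Hypothesis c_size : size c = #|V|.
Hypothesis c_ucycle : ucycle (Bgraph w) c.

(** The default [x0] is never returned, as [c] has length [#|V|]; its existence also makes [V]
    nonempty. *)
Definition cycle_walk i := nth x0 c (i %% #|V|).

Let V_gt0 : (0 < #|V|)%N. Proof. by apply/card_gt0P; exists x0. Qed.

Lemma cycle_walk_eq i j : cycle_walk i = cycle_walk j <-> i = j %[mod #|V|].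
Proof.
rewrite /cycle_walk; split=> [/eqP|-> //].
case/andP: c_ucycle => _ c_uniq.
by rewrite nth_uniq ?c_size ?ltn_pmod // => /eqP.
Qed.

Lemma cycle_walk_onto v : exists i, v = cycle_walk i.
Proof.
case/andP: c_ucycle => _ c_uniq.
have v_c : v \in c.
  have c_sub : {subset c <= enum V} by move=> u _; rewrite mem_enum.
  have [|_ ->] := uniq_min_size c_uniq c_sub; last by rewrite mem_enum.
  by rewrite -cardE c_size.
exists (index v c); rewrite /cycle_walk modn_small ?nth_index //.
by rewrite -c_size index_mem.
Qed.

Lemma cycle_walk_step i : Bgraph w (cycle_walk i) (cycle_walk i.+1).
Proof.
have := ltn_pmod i V_gt0; rewrite /cycle_walk -(addn1 i) -modnDml.
move: (i %% #|V|)%N => k; rewrite addn1 -c_size => k_lt.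
case/andP: c_ucycle => c_cycle _.
case: c c_cycle k_lt => [//|y p] /= /(pathP x0); rewrite size_rcons => py k_lt.
have := py k k_lt; rewrite -rcons_cons !nth_rcons /= k_lt.
(* The last index uses the closing edge of the cycle, back to the head [y]. *)
move: k_lt; rewrite ltnS leq_eqVlt => /predU1P[->|k_lt].
  by rewrite ltnn eqxx modnn.
by rewrite k_lt modn_small // ltnS.
Qed.

End CycleLabelling.

(** * Assembly from the given labelling *)

Theorem theorem3p7 (R : rcfType) (V : finType) (w : V -> V -> nat)
    (n_ge3 : (3 <= #|V|)%N)
    (w_mgraph : mgraph012 w)
    (w_main : two_main_eigenvalues (adjmx R w))
    (w_cycle : isomorphic (Bgraph w) (@cycle_graph #|V|))
    (a b : int)
    (w_ab : forall v : V, a * (deg w v)%:Z + b = (sdeg w v)%:Z)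
    (u1 u2 v1 v2 : V) (us xs vs : seq V)
    (w_lab : cycle_labelling w [:: u1, u2 & us] xs [:: v1, v2 & vs])
    (w_u1v1 : w u1 v1 = 2%N)
    (w_u1u2 : w u1 u2 = 2%N)
    (w_v1v2 : w v1 v2 = 2%N) :
  exists t : nat, (1 <= t)%N /\
    (isomorphic w (@U4 t) \/ isomorphic w (@U5 t)).
Proof.
have [us_size vs_size xs_size] := w_lab.
set c := _ ++ _ => c_ucycle.
have c_size : size c = #|V|.
  by rewrite /c !size_cat size_rev us_size vs_size xs_size; lia.
have w_sym u v : w u v = w v u by case: w_mgraph.
pose x := cycle_walk c u1.
have x_eq : forall i j, x i = x j <-> _ := cycle_walk_eq u1 c_size c_ucycle.
have x_onto := cycle_walk_onto u1 c_size c_ucycle.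
have x_step := cycle_walk_step u1 c_size c_ucycle.
have [m n_eq] : exists m, #|V| = m.+4.
  have V_ge4 : (4 <= #|V|)%N.
    by rewrite -(odd_double_half #|V|) -us_size /=; lia.
  by exists (#|V| - 4)%N; lia.
(* The walk passes [v2], [v1], [u1], [u2] at indices [m.+2] to [m.+4.+1], wrapping at [m.+4]; so the
   three given double edges are consecutive. *)
have c_eq : c = ([:: u1, u2 & us] ++ xs ++ rev vs) ++ [:: v2; v1].
  by rewrite /c !rev_cons -!cats1 -!catA.
have s_size : size ([:: u1, u2 & us] ++ xs ++ rev vs) = m.+2.
  apply/eqP; rewrite -(eqn_add2r 2) (addn2 m.+2) -n_eq -c_size c_eq.
  by rewrite (size_cat _ [:: v2; v1]).
have x_v2 : x m.+2 = v2.
  rewrite /x /cycle_walk n_eq modn_small // c_eq nth_cat s_size.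
  by rewrite ltnn subnn.
have x_v1 : x m.+3 = v1.
  rewrite /x /cycle_walk n_eq modn_small // c_eq nth_cat s_size.
  by rewrite ltnNge leqnSn subSnn.
have x_u1 : x m.+4 = u1 by rewrite /x /cycle_walk n_eq modnn.
have x_u2 : x m.+4.+1 = u2.
  by rewrite /x /cycle_walk n_eq -addn1 modnDl modn_small.
pose e := walk_mult w x.
have e12 : forall i, e i = 1%N \/ e i = 2%N := walk_mult12 w_mgraph x_step.
have e_rule i : _ = _ := walk_rule n_ge3 w_mgraph w_cycle x_eq x_step i w_ab.
have [k ek] :=
  walk_not_all_double n_ge3 w_mgraph w_cycle x_eq x_onto x_step m.+2 w_main.
have [j [ej ej1 ej2 ej3]] : exists j,
    [/\ e j = 2%N, e j.+1 = 2%N, e j.+2 = 2%N & e j.+3 = 1%N].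
  apply: (exists_2221 e12 (k := m.+2) (m := k)) ek;
    by rewrite /e /walk_mult ?x_v2 ?x_v1 ?x_u1 ?x_u2 // w_sym.
have [n2 n2P eP] := propagate_2221 e12 e_rule ej ej1 ej2 ej3.
have /dvdnP[t n_t] : (3 + n2 %| #|V|)%N.
  apply: (period_dvdn n2P _ eP) => i.
  by rewrite /e /walk_mult -addSn !(walk_period x_eq).
exists t; split; first by lia.
have := walk_bracket_isomorphic n_ge3 w_mgraph w_cycle x_eq x_step (n1 := 3)
  (n2 := n2) (t := t) (j := j) erefl.
rewrite n_t mulnC => /(_ erefl eP).
(* A single edge per block gives [U5], two give [U4]. *)
by case: n2P => ->; [right | left].
Qed.
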